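(* Let $\mathfrak A$ be a Hausdorff topological Abelian group and $\mu$ be an $\mathfrak A$-valued $\sigma$-content. Then $\mathfrak C\mu$, $\mathfrak S\mu$, and $\overline{\mathfrak C}\mu$ are $\mathfrak A$-valued $\sigma$-contents.
   Context: $D_\mu$, $R_\mu$ denote the domain and range of a map $\mu$; all maps $\mu$ here have as domain a set of sets. $S[\mu]=\bigcup D_\mu$. Countable means finite or countably infinite. A ring (of sets) is a nonempty set of sets closed under union $A\cup B$ and difference $A\setminus B$. A partition of a set $A$ is a family of pairwise disjoint (possibly empty) sets, indexed by a set $I$, whose union is $A$; it is countable if $I$ is countable. A family $f\colon I\to\mathfrak A$ is summable if the net $J\mapsto\sum_{i\in J}f(i)$ over finite subsets $J\subset I$ converges in $\mathfrak A$; the limit is $\sum_{i\in I}f(i)$. An $\mathfrak A$-valued $\sigma$-content is a map $\mu$ such that $D_\mu$ is a ring, $R_\mu\subset\mathfrak A$, and for every $A\in D_\mu$ and every countable partition $\mathbf A\colon I\to D_\mu$ of $A$ the family $\mu\circ\mathbf A$ is summable with $\mu(A)=\sum_{i\in I}\mu(\mathbf A(i))$. For a set of sets $\mathcal K$, $\hat{\mathcal K}=\{A: A\subset B\text{ for some }B\in\mathcal K\}$. $A\Delta B=(A\setminus B)\cup(B\setminus A)$. For a map $\mu$ with $\varnothing\in D_\mu$, a set $N\in D_\mu$ is $\mu$-null if $\mu(N')=\mu(\varnothing)$ for every $N'\in D_\mu$ with $N'\subset N$; $\mathcal N_\mu$ is the set of all $\mu$-null sets. The map $\mu$ admits completion if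 $D_\mu$ is a ring and $\mu(B_1)=\mu(B_2)$ for all $B_1,B_2\in D_\mu$ with $B_1\Delta B_2\in\mathcal N_\mu$ (every group-valued content, hence every $\sigma$-content, admits completion). If $\mu$ admits completion, a completion ring for $\mu$ is a ring $\mathcal N$ such that $N\cap B\in\mathcal N$ for all $N\in\mathcal N$, $B\in D_\mu$, and $\mathcal N\cap D_\mu=\mathcal N_\mu$. For sets of sets $\mathcal Q,\mathcal N$, $\Delta(\mathcal Q,\mathcal N)=\{A: A\Delta B\in\mathcal N\text{ for some }B\in\mathcal Q\}$. The $\mathcal N$-completion $\mathfrak C_{\mathcal N}\mu$ is the unique (well-defined) map $\nu$ with $D_\nu=\Delta(D_\mu,\mathcal N)$ and $\nu(A)=\mu(B)$ whenever $A\in D_\nu$, $B\in D_\mu$, $A\Delta B\in\mathcal N$. For $\mu$ admitting completion put $\mathcal N_0[\mu]=\{N\subset S[\mu]: N\cap B\in\mathcal N_\mu\text{ for every }B\in D_\mu\}$ and $\mathcal N[\mu]=\{N\subset S[\mu]: N\cap B\in\hat{\mathcal N}_\mu\text{ for every }B\in D_\mu\}$. The sets $\hat{\mathcal N}_\mu$, $\mathcal N_0[\mu]$, $\mathcal N[\mu]$ are completion rings for $\mu$; the corresponding $\mathcal N$-completions of $\mu$ are denoted $\mathfrak C\mu$ (completion), $\mathfrak S\mu$ (saturation) and $\overline{\mathfrak C}\mu$ (essential completion), respectively. *)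

(* Defs.v *)
From HB Require Import structures.
From mathcomp Require Import all_boot all_algebra finmap.
From mathcomp Require Import all_classical all_reals all_analysis.
From mathcomp.analysis.showcase Require summability.

Set Implicit Arguments.
Unset Strict Implicit.
Unset Printing Implicit Defensive.

Import GRing.Theory.

Local Open Scope classical_set_scope.

(* A map whose domain is a set of subsets of T. The values of [sval_of] outside
   [sdom] are junk, so two such maps are the same when they have the same domain
   and agree on it. *)
Record set_map (T V : Type) := SetMap {
  sdom : set (set T);
  sval_of :> set T -> V }.

Section completion.
Context {T V : Type}.
Implicit Types (mu nu : set_map T V).

Definition carrier mu : set T := \bigcup_(A in sdom mu) A.

Definition subset_closure (K : set (set T)) : set (set T) :=
  [set A | exists2 B, K B & A `<=` B].

Definition null_sets mu : set (set T) :=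
  [set N | sdom mu N /\
           forall N', sdom mu N' -> N' `<=` N -> mu N' = mu set0].

Definition admits_completion mu :=
  setring (sdom mu) /\
  forall B1 B2, sdom mu B1 -> sdom mu B2 -> null_sets mu (B1 `+` B2) ->
    mu B1 = mu B2.

Definition completion_ring mu (N : set (set T)) :=
  [/\ setring N,
      (forall M B, N M -> sdom mu B -> N (M `&` B)) &
      N `&` sdom mu = null_sets mu].

Definition Delta (Q N : set (set T)) : set (set T) :=
  [set A | exists2 B, Q B & N (A `+` B)].

(* The value at A is mu B for a chosen B in the domain of mu with A `+` B in N;
   it does not depend on the choice as soon as mu admits completion and N is a
   completion ring, see [Ncompletion_val] and [Ncompletion_unique]. *)
Definition Ncompletion (N : set (set T)) mu : set_map T V :=
  SetMap (Delta (sdom mu) N)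
    (fun A => mu (xget set0 [set B | sdom mu B /\ N (A `+` B)])).

Definition null_hat mu := subset_closure (null_sets mu).

Definition local_null mu : set (set T) :=
  [set N | N `<=` carrier mu /\
           forall B, sdom mu B -> null_sets mu (N `&` B)].

Definition ess_null mu : set (set T) :=
  [set N | N `<=` carrier mu /\
           forall B, sdom mu B -> null_hat mu (N `&` B)].

Definition completion mu := Ncompletion (null_hat mu) mu.
Definition saturation mu := Ncompletion (local_null mu) mu.
Definition ess_completion mu := Ncompletion (ess_null mu) mu.

Lemma null_subset mu N N' :
  null_sets mu N -> sdom mu N' -> N' `<=` N -> null_sets mu N'.
Proof.
move=> [_ nN] dN' N'N; split => // N'' dN'' N''N'.
exact: nN dN'' (subset_trans N''N' N'N).
Qed.

Lemma setring_setI (K : set (set T)) A B : setring K -> K A -> K B ->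
  K (A `&` B).
Proof. by move=> [_ _ KD] KA KB; rewrite -setDD; exact: KD _ _ KA (KD _ _ KA KB). Qed.

Lemma setring_setY (K : set (set T)) A B : setring K -> K A -> K B ->
  K (A `+` B).
Proof. by move=> [_ KU KD] KA KB; apply: KU; exact: KD. Qed.

Lemma setY_trans_sub (A B C : set T) : B `+` C = (A `+` B) `+` (A `+` C).
Proof. by rewrite (setYC A) setYA -(setYA B) setYK setY0. Qed.

Lemma Ncompletion_val mu N A B :
  admits_completion mu -> completion_ring mu N ->
  sdom mu B -> N (A `+` B) -> Ncompletion N mu A = mu B.
Proof.
move=> [rD wd] [rN _ NE] dB NAB /=.
case: xgetP => [C _ [dC NAC]|/(_ B) nB]; last by case: nB.
apply: wd => //; rewrite -NE; split; last exact: setring_setY.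
by rewrite (setY_trans_sub A); exact: setring_setY.
Qed.

Lemma Ncompletion_unique mu N nu :
  admits_completion mu -> completion_ring mu N ->
  sdom nu = Delta (sdom mu) N ->
  (forall A B, sdom nu A -> sdom mu B -> N (A `+` B) -> nu A = mu B) ->
  forall A, sdom nu A -> nu A = Ncompletion N mu A.
Proof.
move=> amu cN dnu vnu A dA; have := dA; rewrite dnu => -[B dB NAB].
by rewrite (vnu _ _ dA dB NAB) (Ncompletion_val amu cN dB NAB).
Qed.

Section rings.
Variable mu : set_map T V.
Hypothesis amu : admits_completion mu.

Let rD : setring (sdom mu). Proof. by case: amu. Qed.

Lemma null_sets_setring : setring (null_sets mu).
Proof.
have [D0 DU DD] := rD.
split.
- by split=> // N' _; rewrite subset0 => ->.
- move=> A B [dA nA] [dB nB]; split; first exact: DU.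
  move=> N' dN' N'AB.
  rewrite -(nB (N' `\` A)); [|exact: DD|by move=> x [/N'AB[]]].
  have dAN' : sdom mu (N' `&` A) by exact: setring_setI.
  apply: (proj2 amu) => //; first exact: DD.
  have -> : N' `+` (N' `\` A) = N' `&` A.
    by rewrite -setYD setYA setYK setYC setY0.
  by apply: (null_subset (conj dA nA)) => // x [].
- by move=> A B nA [dB _]; apply: (null_subset nA); [apply: DD => //; case: nA|move=> x []].
Qed.

Lemma null_hat_setring : setring (null_hat mu).
Proof.
have [N0 NU ND] := null_sets_setring.
split; first by exists set0.
- by move=> A B [A' nA AA'] [B' nB BB']; exists (A' `|` B'); [exact: NU|exact: setUSS].
- by move=> A B [A' nA AA'] _; exists A' => // x [/AA'].
Qed.

Lemma null_hat_completion_ring : completion_ring mu (null_hat mu).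
Proof.
split; first exact: null_hat_setring.
- by move=> M B [M' nM MM'] _; exists M' => // x [/MM'].
- apply/seteqP; split=> [M [[M' nM MM'] dM]|M nM].
    exact: null_subset nM dM MM'.
  by split; [exists M|case: nM].
Qed.

Let local_ring (Z : set (set T)) : setring Z ->
  (forall M B, Z M -> sdom mu B -> Z (M `&` B)) ->
  (forall M, null_sets mu M -> Z M) ->
  (forall M, Z M -> sdom mu M -> null_sets mu M) ->
  completion_ring mu
    [set N | N `<=` carrier mu /\ forall B, sdom mu B -> Z (N `&` B)].
Proof.
move=> [Z0 ZU ZD] ZI nZ Zn; split.
- split.
  + by split=> // B _; rewrite set0I.
  + move=> A B [sA zA] [sB zB]; split; first by rewrite subUset.
    by move=> C dC; rewrite setIUl; apply: ZU; [exact: zA|exact: zB].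
  + move=> A B [sA zA] [sB zB]; split; first by move=> x [/sA].
    move=> C dC; have -> : (A `\` B) `&` C = (A `&` C) `\` (B `&` C).
      apply/seteqP; split=> x; first by move=> [[? ?] ?]; split=> // -[].
      by move=> [[? ?] nBC]; split=> //; split=> // ?; exact: nBC.
    by apply: ZD; [exact: zA|exact: zB].
- move=> M B [sM zM] dB; split; first by move=> x [/sM].
  by move=> C dC; rewrite setIAC; apply: ZI => //; exact: zM.
- apply/seteqP; split=> [M [[sM zM] dM]|M nM].
    by apply: Zn => //; rewrite -(setIid M); exact: zM.
  have dM : sdom mu M by case: nM.
  split=> //; split; first by move=> x Mx; exists M.
  by move=> B dB; apply: ZI => //; exact: nZ.
Qed.

Lemma local_null_completion_ring : completion_ring mu (local_null mu).
Proof.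
apply: local_ring => //; first exact: null_sets_setring.
move=> M B nM dB; apply: (null_subset nM); last by move=> x [].
by apply: setring_setI => //; case: nM.
Qed.

Lemma ess_null_completion_ring : completion_ring mu (ess_null mu).
Proof.
have [rH hI hE] := null_hat_completion_ring.
apply: local_ring => //; first by move=> M nM; exists M.
by move=> M hM dM; rewrite -hE.
Qed.

End rings.
End completion.

(* The net of finite partial sums of f converges to s; in a Hausdorff group this
   is the summability of f together with the equality of its sum with s. *)
Definition has_sum {I : choiceType} {A : topologicalZmodType}
    (f : I -> A) (s : A) : Prop :=
  summability.partial_sum f @ summability.totally --> s.

(* The blocks of a partition may be empty here, contrary to those of
   [classical_sets.partition]. *)
Definition countable_partition {T : Type} {I : choiceType}
    (F : I -> set T) (E : set T) : Prop :=
  [/\ countable [set: I], trivIset [set: I] F & \bigcup_i F i = E].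

Definition sigma_content {T : Type} {A : topologicalZmodType}
    (mu : set_map T A) : Prop :=
  setring (sdom mu) /\
  forall (E : set T) (I : choiceType) (F : I -> set T),
    sdom mu E -> (forall i, sdom mu (F i)) -> countable_partition F E ->
    has_sum (mu \o F) (mu E).


Section sigma_content_admits_completion.
Context {T : Type} {A : topologicalZmodType}.
Variable mu : set_map T A.
Hypotheses (hA : hausdorff_space A) (hmu : sigma_content mu).

Lemma sigma_content_additive E F : sdom mu E -> sdom mu F -> E `&` F = set0 ->
  mu (E `|` F) = (mu E + mu F)%R.
Proof.
move=> dE dF EF0; have [[D0 DU DD] smu] := hmu.
pose G (b : bool) := if b then E else F.
have cG : has_sum (mu \o G) (mu (E `|` F)).
  apply: smu => //; [exact: DU|by case|split; first exact: countableP].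
  - apply/trivIsetP => -[] [] // _ _ _; rewrite /G //.
    by rewrite setIC.
  - apply/seteqP; split=> [x [[] _ Gx]|x [Ex|Fx]].
    + by left.
    + by right.
    + by exists true.
    + by exists false.
have pf := @summability.totally_filter bool.
apply: (@cvg_unique _ hA _ _ _ _ cG).
apply: cvg_near_cst.
exists [fset true; false]%fset => //= J sJ.
have -> : J = [fset true; false]%fset.
  by apply/fsetP=> b; rewrite (fsubsetP sJ) ?inE; case: b; rewrite ?inE.
rewrite /summability.partial_sum.
rewrite -(big_seq_fsetE _ _ predT (mu \o G)) /=.
by rewrite big_fsetU1 ?inE //= big_seq_fset1.
Qed.

Lemma sigma_content0 : mu set0 = 0%R.
Proof.
have [[D0 _ _] _] := hmu.
have /eqP := sigma_content_additive D0 D0 (setI0 _).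
by rewrite setU0 -[X in X == _]addr0 => /eqP/addrI.
Qed.

Lemma sigma_content_admits_completion : admits_completion mu.
Proof.
have [rD _] := hmu; split=> //; have [D0 DU DD] := rD.
move=> B C dB dC [dY nY].
have split_mu X Y : sdom mu X -> sdom mu Y -> X `\` Y `<=` B `+` C ->
    mu X = mu (X `&` Y).
  move=> dX dY' s; rewrite -{1}(setUIDK X Y) sigma_content_additive.
  - by rewrite (nY (X `\` Y)) ?sigma_content0 ?addr0 //; exact: DD.
  - exact: setring_setI.
  - exact: DD.
  - by rewrite setIDA setDE; apply/seteqP; split=> x // [[[_ ?] _]].
rewrite (split_mu _ _ dB dC); last by left.
by rewrite (split_mu _ _ dC dB) 1?setIC//; right.
Qed.

End sigma_content_admits_completion.

(* Main.v *)
Require Import Defs.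
From mathcomp Require Import all_boot all_algebra.
From mathcomp Require Import all_classical all_reals all_analysis.

(** A countable partition [F] of [E] in the domain of the completion has to be
replaced by a countable partition [H] of a set [B] in the domain of [mu], with
[H i] equivalent to [F i] and [B] equivalent to [E] modulo the completion ring
[N]; the sum formula for [mu] along [H] is then the one for the completion
along [F]. As the domain of [mu] is only a ring, the exceptional sets cannot be
collected into one set of the domain, and the approximants are
chosen so that no exceptional set remains. First, [B] is taken inside [E]
([Delta_inner]), so that the sets [B `&` F i] cover [B]. Next, each
[B `&` F i] is enlarged inside [B] to an equivalent set [G i] in the domain
([Delta_outer]); the [G i] cover [B] exactly. They are made disjoint
by removing from [G i] the finitely many earlier [G j]
([Delta_partition]); this changes [G i] only modulo [N] because the [F i] are
disjoint.

Both approximations need just one property of [N] besides its being a completion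
ring: the trace on a set of the domain of any member of [N] is covered by a null
set. It holds for all three completion rings, so one argument
([Ncompletion_sigma_content]) treats the three completions. *)

Set Implicit Arguments.
Unset Strict Implicit.
Unset Printing Implicit Defensive.

Local Open Scope classical_set_scope.

Lemma setYACA {T : Type} : interchange (@setY T) (@setY T).
Proof. by move=> A B C D; rewrite -!setYA (setYA B) (setYC B C) !setYA. Qed.

(** * Equivalence modulo a completion ring *)

Section modulo.
Context {T V : Type}.
Variables (mu : set_map T V) (N : set (set T)).
Hypotheses (amu : admits_completion mu) (cN : completion_ring mu N).

Let rD : setring (sdom mu). Proof. by case: amu. Qed.
Let rN : setring N. Proof. by case: cN. Qed.

Lemma null_sets_sub_ring M : null_sets mu M -> N M.
Proof. by case: cN => _ _ <- []. Qed.

Lemma modN_trans Y X Z : N (X `+` Y) -> N (Y `+` Z) -> N (X `+` Z).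
Proof. by move=> XY YZ; rewrite (setY_trans_sub Y) (setYC Y X); exact: setring_setY. Qed.

Lemma modN_setY X Y B C :
  N (X `+` B) -> N (Y `+` C) -> N ((X `+` Y) `+` (B `+` C)).
Proof. by move=> XB YC; rewrite setYACA; exact: setring_setY. Qed.

(** The members of [N] need not be stable under intersection with arbitrary sets,
which is why [B] and [C] are taken in the domain. *)
Lemma modN_setI X Y B C : sdom mu B -> sdom mu C ->
  N (X `+` B) -> N (Y `+` C) -> N ((X `&` Y) `+` (B `&` C)).
Proof.
move=> dB dC XB YC; have [_ NI _] := cN.
apply: (@modN_trans (X `&` C)); rewrite -?setIYr -?setIYl; last exact: NI.
have -> : X = (X `+` B) `+` B by rewrite -setYA setYK setY0.
rewrite setIYl setIC; apply: setring_setY => //.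
  by rewrite setIC; exact: setring_setI.
by rewrite setIC; exact: NI.
Qed.

Lemma modN_setD X Y B C : sdom mu B -> sdom mu C ->
  N (X `+` B) -> N (Y `+` C) -> N ((X `\` Y) `+` (B `\` C)).
Proof.
by move=> dB dC XB YC; rewrite -!setYD; apply: modN_setY => //; exact: modN_setI.
Qed.

Lemma modN_setU X Y B C : sdom mu B -> sdom mu C ->
  N (X `+` B) -> N (Y `+` C) -> N ((X `|` Y) `+` (B `|` C)).
Proof.
move=> dB dC XB YC; rewrite -!setYU; apply: modN_setY; last exact: modN_setI.
exact: modN_setY.
Qed.

Lemma Delta_setring : setring (Delta (sdom mu) N).
Proof.
have [D0 DU DD] := rD; split.
- by exists set0 => //; rewrite setYK; case: rN.
- by move=> X Y [B dB XB] [C dC YC]; exists (B `|` C); [exact: DU|exact: modN_setU].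
- by move=> X Y [B dB XB] [C dC YC]; exists (B `\` C); [exact: DD|exact: modN_setD].
Qed.

(** * Approximation by sets of the domain *)

Hypothesis covN : forall M C, N M -> sdom mu C -> null_hat mu (M `&` C).

(** Add to a set [B] equivalent to [X] a null set covering what [B] misses
of [X] inside [C]. *)
Lemma Delta_outer X C : Delta (sdom mu) N X -> sdom mu C ->
  exists G, [/\ sdom mu G, X `&` C `<=` G, G `<=` C & N ((X `&` C) `+` G)].
Proof.
have [_ DU _] := rD; move=> [B dB XB] dC.
have [K nK XBK] := covN XB dC.
have dK : sdom mu K by case: nK.
exists ((B `|` K) `&` C); split.
- by apply: setring_setI => //; exact: DU.
- move=> x [Xx Cx]; split=> //; have [Bx|nBx] := pselect (B x); first by left.
  by right; apply: XBK; split=> //; left.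
- by move=> x [].
- apply: modN_setI => //; [exact: DU| |by rewrite setYK; case: rN].
  rewrite -(setU0 X); apply: modN_setU => //.
  by rewrite setYC setY0; exact: null_sets_sub_ring.
Qed.

(** Remove from a set [C] equivalent to [X] a null set covering [C `\` X]. *)
Lemma Delta_inner X : Delta (sdom mu) N X ->
  exists B, [/\ sdom mu B, B `<=` X & N (X `+` B)].
Proof.
have [_ _ DD] := rD; move=> [C dC XC].
have [K nK XCK] := covN XC dC.
have dK : sdom mu K by case: nK.
exists (C `\` K); split; first exact: DD.
- move=> x [Cx nKx]; apply: contrapT => nXx; apply: nKx.
  by apply: XCK; split=> //; right.
- rewrite -(setD0 X); apply: modN_setD => //.
  by rewrite setYC setY0; exact: null_sets_sub_ring.
Qed.

(** * Replacing a partition by one in the domain *)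

Section disjointify.
Context {I : Type} (f : I -> nat).
Hypothesis finj : injective f.

Definition below (X : I -> set T) n := \bigcup_(j in [set j | f j < n]) X j.

Lemma belowS X i : below X (f i).+1 = below X (f i) `|` X i.
Proof.
apply/seteqP; split=> x.
  move=> [j /=]; rewrite ltnS leq_eqVlt => /orP[/eqP/finj ->|ji] Xx; first by right.
  by left; exists j.
by move=> [[j /= ji Xx]|Xx]; [exists j => //=; exact: ltnW|exists i => /=].
Qed.

Lemma below_skip X n : (forall i, f i <> n) -> below X n.+1 = below X n.
Proof.
move=> nf; apply/seteqP; split=> x [j /= ji Xx]; exists j => //=; last exact: ltnW.
by move: ji; rewrite ltnS leq_eqVlt => /orP[/eqP/nf|].
Qed.

(** As [f] is injective, each step of the induction adds at most one set. *)
Lemma below_modN F G : (forall i, sdom mu (G i)) -> (forall i, N (F i `+` G i)) ->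
  forall n, sdom mu (below G n) /\ N (below F n `+` below G n).
Proof.
have [D0 DU _] := rD; move=> dG FG; elim=> [|n [dn Nn]].
  have b0 X : below X 0 = set0 by apply/seteqP; split=> x [].
  by rewrite !b0 setYK; split=> //; case: rN.
have [[i fi]|nf] := pselect (exists i, f i = n).
  move: dn Nn; rewrite -fi !belowS => dn Nn; split; first exact: DU.
  exact: modN_setU.
by rewrite !below_skip // => i fi; apply: nf; exists i.
Qed.

Lemma trivIset_below F i : trivIset [set: I] F -> F i `\` below F (f i) = F i.
Proof.
move=> tF; apply/seteqP; split=> x; first by case.
move=> Fx; split=> // -[j /= ji Fjx].
by have E := tF j i Logic.I Logic.I (ex_intro _ x (conj Fjx Fx)); rewrite E ltnn in ji.
Qed.

Lemma trivIset_disjointify G : trivIset [set: I] (fun i => G i `\` below G (f i)).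
Proof.
move=> i j _ _ [x [[Gi ni] [Gj nj]]]; apply: finj.
by case: (ltngtP (f i) (f j)) => // ij; [case: nj; exists i|case: ni; exists j].
Qed.

Lemma bigcup_disjointify G : \bigcup_i (G i `\` below G (f i)) = \bigcup_i G i.
Proof.
apply/seteqP; split=> x [i _]; first by move=> [Gx _]; exists i.
(* descend to the earliest [G j] that contains [x] *)
have [n] := ubnP (f i); elim: n i => // n IH i; rewrite ltnS => fn Gx.
have [[j /= ji Gjx]|nb] := pselect (below G (f i) x); last by exists i.
by apply: (IH j) => //; exact: leq_trans fn.
Qed.

End disjointify.

Lemma Delta_partition (E : set T) (I : choiceType) (F : I -> set T) :
  Delta (sdom mu) N E -> (forall i, Delta (sdom mu) N (F i)) ->
  countable_partition F E ->
  exists B (H : I -> set T), [/\ sdom mu B, N (E `+` B),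
    forall i, sdom mu (H i) /\ N (F i `+` H i) & countable_partition H B].
Proof.
have [_ _ DD] := rD; move=> dE dF [cI tF FE].
have [f finj'] := countable_injP _ cI.
have finj : injective f by move=> i j; apply: finj'; rewrite inE.
have [B [dB BE EB]] := Delta_inner dE.
have [G GP] := choice (fun i => Delta_outer (dF i) dB).
have dG i : sdom mu (G i) by case: (GP i).
have FG i : N (F i `+` G i).
  have [_ _ _] := GP i; apply: modN_trans.
  (* [F i] lies in [E] and [E] is equivalent to [B], so [F i] is equivalent to
     its trace on [B] *)
  have {1}-> : F i = F i `&` E by apply/esym/setIidl; rewrite -FE; exact: bigcup_sup.
  have [C dC FC] := dF i.
  apply: (@modN_trans (C `&` B)); first exact: modN_setI.
  rewrite setYC; apply: modN_setI => //; rewrite setYK; by case: rN.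
exists B, (fun i => G i `\` below f G (f i)); split=> //.
- move=> i; have [db Nb] := below_modN finj dG FG (f i).
  by split; [exact: DD|rewrite -(trivIset_below f i tF); exact: modN_setD].
- split=> //; first exact: trivIset_disjointify.
  rewrite bigcup_disjointify; apply/seteqP; split=> x.
    by move=> [i _]; case: (GP i) => _ _ GB _ /GB.
  move=> Bx; have := BE _ Bx; rewrite -FE => -[i _ Fx]; exists i => //.
  by case: (GP i) => _ FBG _ _; exact: FBG.
Qed.

End modulo.

(** * The three completions *)

Section completions.
Context {T : Type} {A : topologicalZmodType}.
Variable mu : set_map T A.
Hypotheses (hA : hausdorff_space A) (hmu : sigma_content mu).

Let amu : admits_completion mu.
Proof. exact: sigma_content_admits_completion. Qed.

Lemma Ncompletion_sigma_content (N : set (set T)) : completion_ring mu N ->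
  (forall M C, N M -> sdom mu C -> null_hat mu (M `&` C)) ->
  sigma_content (Ncompletion N mu).
Proof.
move=> cN covN; split; first exact: Delta_setring.
move=> E I F dE dF pF.
have [B [H [dB EB HP pH]]] := Delta_partition amu cN covN dE dF pF.
rewrite (Ncompletion_val amu cN dB EB).
have -> : Ncompletion N mu \o F = mu \o H.
  apply/funext=> i; have [dH FH] := HP i.
  exact: Ncompletion_val amu cN dH FH.
by apply: (proj2 hmu) => // i; case: (HP i).
Qed.

End completions.

Theorem proposition5p6 (T : Type) (A : topologicalZmodType)
    (mu : set_map T A) (hA : hausdorff_space A) (hmu : sigma_content mu) :
  [/\ sigma_content (completion mu),
      sigma_content (saturation mu) &
      sigma_content (ess_completion mu)].
Proof.
have amu := sigma_content_admits_completion hA hmu.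
split; apply: Ncompletion_sigma_content => //.
- exact: null_hat_completion_ring.
- by move=> M C [K nK MK] _; exists K => // x [/MK].
- exact: local_null_completion_ring.
- by move=> M C [_ nM] dC; exists (M `&` C) => //; exact: nM.
- exact: ess_null_completion_ring.
- by move=> M C [_ nM] dC; exact: nM.
Qed.
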